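(* The map $\beta:\mathcal{T}\to\mathcal{M}$ and its inverse map $\bar\beta:\mathcal{M}\to\mathcal{T}$ are size-preserving bijections between Fishburn trees and Fishburn matrices. In particular, for each $n\ge1$ we have $|\mathcal{T}_n|=|\mathcal{M}_n|$.
   Context: Write $[k]=\{1,\dots,k\}$. A binary tree is either empty or a triple $T=(L,r,R)$ with $r$ a node (the root) and $L,R$ binary trees (left and right subtree). $V(T)$ is the set of nodes and the size of $T$ is $|V(T)|$. A vertex labeling is a map $\mathfrak{l}:V(T)\to\{1,2,\dots\}$; $\max(T)$ is the largest label, with $\max(\emptyset)=0$. Labeled binary trees are considered up to label-preserving isomorphism of binary trees. $T$ is decreasing if it is empty, or $T=(L,r,R)$ with $L,R$ decreasing and $\mathfrak{l}(r)\ge\max\{\max(L),\max(R)\}$. $T$ is strictly decreasing to the left if it is empty, or $T=(L,r,R)$ with $\mathfrak{l}(r)>\max(L)$ and $L,R$ strictly decreasing to the left. An endotree of size $n$ is a decreasing binary tree of size $n$ that is strictly decreasing to the left and has all labels in $[n]$; it is regular if the set of its labels equals $[k]$ for some $k\le n$. The in-order traversal of $T=(L,r,R)$ traverses $L$ recursively, then visits $r$, then traverses $R$ recursively; $v_i$ is the $i$-th visited node. Put $\mathrm{asctops}(T)=\{v_1\}\cup\{v_i: v_i\text{ has a left child}\}$ and $\mathrm{nub}(T)=\{v_j:\mathfrak{l}(v_i)\ne\mathfrak{l}(v_j)\text{ for each }i<j\}$ (both empty for the empty tree). A Fishburn tree is a regular endotree $T$ with $\mathrm{nub}(T)=\mathrm{asctops}(T)$;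 $\mathcal{T}$ is the set of Fishburn trees and $\mathcal{T}_n$ the set of those of size $n$. A maximal right path is a nonempty sequence of nodes $(w_1,\dots,w_m)$ with $w_{i+1}$ the right child of $w_i$, where $w_1$ is not a right child of any node and $w_m$ has no right child; maximal left paths are defined analogously. $\mathrm{rpath}(v)$ and $\mathrm{lpath}(v)$ are the unique maximal right and left paths containing $v$. For nonempty $T$ with root $r$, $\mathrm{diag}(T)=\mathrm{lpath}(r)$ (viewed as a set; it is contained in $\mathrm{asctops}(T)$) and $\overline{\mathrm{diag}}(T)=\mathrm{asctops}(T)\setminus\mathrm{diag}(T)$. For a Fishburn tree $T$ with $k=\max(T)$, the set $\mathrm{asctops}(T)$ has exactly one node of each label $i\in[k]$. If $v\in\mathrm{asctops}(T)$ has label $i$, let $W_i=\mathrm{rpath}(v)$ if $v\in\mathrm{diag}(T)$, and $W_i=\mathrm{rpath}(\mathrm{lchild}(v))$ if $v\in\overline{\mathrm{diag}}(T)$, where $\mathrm{lchild}(v)$ is the left child of $v$; $W_1,\dots,W_k$ are exactly the maximal right paths of $T$. Let $B_i$ be the multiset $\{\mathfrak{l}(u):u\in W_i\}$ and $\mathfrak{P}(T)=B_1\dots B_k$. A Fishburn matrix is a lower triangular square matrix with nonnegative integer entries such that every row and every column contains at least one nonzero entry; its size is the sum of its entries. $\mathcal{M}$ is the set of Fishburn matrices (including the $0\times0$ matrix, corresponding to the empty tree) and $\mathcal{M}_n$ those of size $n$. For a Fishburn tree $T$ with $k=\max(T)$, $\beta(T)$ is the $k\times k$ matrix whose $(i,j)$-th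 entry is the number of nodes of label $j$ in $W_i$. For a $k\times k$ Fishburn matrix $A=(a_{i,j})$, let $B_i$ be the multiset containing exactly $a_{i,j}$ copies of $j$ for each $j\in[k]$; $\bar\beta(A)$ is the unique Fishburn tree $T$ with $\mathfrak{P}(T)=B_1\dots B_k$ (such a tree exists and is unique for every list of $k$ nonempty multisets whose elements form exactly the set $[k]$ and such that $j\in B_i$ implies $j\le i$). *)

(* Defs.v *)
From HB Require Import structures.
From mathcomp Require Import all_boot all_order all_algebra.
From mathcomp Require Import finmap multiset.
From mathcomp Require Import mathcomp_extra boolp classical_sets functions.
From mathcomp Require Import cardinality.

Set Implicit Arguments.
Unset Strict Implicit.
Unset Printing Implicit Defensive.

(* Vertex-labeled binary trees up to label-preserving isomorphism. Labels are
   arbitrary naturals here; [endotree] restricts them to [1, n]. *)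
Inductive tree := Empty | Branch of tree & nat & tree.

Fixpoint tree_code (T : tree) : GenTree.tree nat :=
  if T is Branch L l R
  then GenTree.Node 1 [:: GenTree.Leaf l; tree_code L; tree_code R]
  else GenTree.Node 0 [::].

Fixpoint tree_decode (t : GenTree.tree nat) : option tree :=
  match t with
  | GenTree.Node 0 [::] => Some Empty
  | GenTree.Node 1 [:: GenTree.Leaf l; tL; tR] =>
      if (tree_decode tL, tree_decode tR) is (Some L, Some R)
      then Some (Branch L l R) else None
  | _ => None
  end.

Lemma tree_codeK : pcancel tree_code tree_decode.
Proof. by elim=> //= L -> l R ->. Qed.

HB.instance Definition _ := Countable.copy tree (pcan_type tree_codeK).

(* A node is the sequence of directions leading to it from the root:
   [false] = left, [true] = right. *)
Definition node := seq bool.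

Definition root_node : node := [::].
Definition child (b : bool) (v : node) : node := rcons v b.
Notation lchild := (child false).
Notation rchild := (child true).

(* The in-order sequence v_1, v_2, ... of all nodes; as a collective predicate
   it is also the vertex set V(T). *)
Fixpoint inorder (T : tree) : seq node :=
  if T is Branch L _ R
  then map (cons false) (inorder L) ++ root_node :: map (cons true) (inorder R)
  else [::].

Definition tree_size (T : tree) : nat := size (inorder T).

(* Dummy value 0 outside V(T). *)
Fixpoint label (T : tree) (v : node) : nat :=
  match T, v with
  | Empty, _ => 0
  | Branch _ l _, [::] => l
  | Branch L _ R, b :: v' => label (if b then R else L) v'
  end.

Fixpoint maxlabel (T : tree) : nat :=
  if T is Branch L l R then maxn l (maxn (maxlabel L) (maxlabel R)) else 0.

Fixpoint decreasing (T : tree) : bool :=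
  if T is Branch L l R
  then [&& decreasing L, decreasing R & maxn (maxlabel L) (maxlabel R) <= l]
  else true.

Fixpoint strictly_decreasing_left (T : tree) : bool :=
  if T is Branch L l R
  then [&& maxlabel L < l, strictly_decreasing_left L
         & strictly_decreasing_left R]
  else true.

Definition endotree (T : tree) : bool :=
  [&& decreasing T, strictly_decreasing_left T
    & all (fun v => 1 <= label T v <= tree_size T) (inorder T)].

Definition regular (T : tree) : Prop :=
  exists2 k, k <= tree_size T & map (label T) (inorder T) =i iota 1 k.

Definition asctops (T : tree) : seq node :=
  [seq v <- inorder T
     | (index v (inorder T) == 0) || (lchild v \in inorder T)].

Definition nub (T : tree) : seq node :=
  [seq v <- inorder T
     | all (fun u => label T u != label T v)
           (take (index v (inorder T)) (inorder T))].

Definition fishburn_tree (T : tree) : Prop :=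
  [/\ endotree T, regular T & nub T =i asctops T].

(* Maximal left ([b = false]) and right ([b = true]) paths. *)
Definition maxpath (b : bool) (T : tree) (p : seq node) : bool :=
  [&& p != [::],
      all (fun u => u \in inorder T) p,
      sorted (fun u w => w == child b u) p,
      all (fun u => head root_node p != child b u) (inorder T)
    & child b (last root_node p) \notin inorder T].

(* Here and below, "the unique x such that P" is rendered by [xget d P]: some x
   in P, or d if there is none; uniqueness is not built in. *)
Definition path_through (b : bool) (T : tree) (v : node) : seq node :=
  xget [::] [set p | maxpath b T p /\ v \in p].

Definition lpath := path_through false.
Definition rpath := path_through true.

Definition diag (T : tree) : seq node := lpath T root_node.

(* The node of asctops(T) with label i, for 1 <= i <= max(T). *)
Definition asctop (T : tree) (i : nat) : node :=
  xget root_node [set v | v \in asctops T /\ label T v = i].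

Definition W (T : tree) (i : nat) : seq node :=
  let v := asctop T i in
  if v \in diag T then rpath T v else rpath T (lchild v).

Definition blocks_of_tree (T : tree) : seq {mset nat}%mset :=
  [seq seq_mset (map (label T) (W T i)) | i <- iota 1 (maxlabel T)].

(* Square matrices of arbitrary size k over nat; index i : 'I_k stands for the
   row, column or label i + 1. *)
Definition sqmatrix := {k : nat & 'M[nat]_k}.

Definition mxsize (A : sqmatrix) : nat :=
  \sum_(i < tag A) \sum_(j < tag A) tagged A i j.

Definition fishburn_matrix (A : sqmatrix) : Prop :=
  [/\ is_trig_mx (tagged A),
      forall i, exists j, tagged A i j != 0
    & forall j, exists i, tagged A i j != 0].

Definition blocks_of_matrix (A : sqmatrix) : seq {mset nat}%mset :=
  [seq (\big[msetD/mset0]_(j < tag A) msetn (tagged A i j) j.+1)%mset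
     | i <- enum 'I_(tag A)].

Definition beta (T : tree) : sqmatrix :=
  Tagged (fun k => 'M[nat]_k)
    (\matrix_(i < maxlabel T, j < maxlabel T)
       count (fun u => label T u == j.+1) (W T i.+1))%R.

Definition betabar (A : sqmatrix) : tree :=
  xget Empty
    [set T | fishburn_tree T /\ blocks_of_tree T = blocks_of_matrix A].

Definition fishburn_trees : set tree := [set T | fishburn_tree T].
Definition fishburn_trees_of_size (n : nat) : set tree :=
  [set T | fishburn_tree T /\ tree_size T = n].

Definition fishburn_matrices : set sqmatrix := [set A | fishburn_matrix A].
Definition fishburn_matrices_of_size (n : nat) : set sqmatrix :=
  [set A | fishburn_matrix A /\ mxsize A = n].

(* Main.v *)
Require Import Defs.
From mathcomp Require Import all_boot all_order all_algebra.
From mathcomp Require Import finmap multiset zify.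
From mathcomp Require Import mathcomp_extra boolp classical_sets functions.
From mathcomp Require Import cardinality.

(** A Fishburn tree is determined by the lists [B_1, ..., B_k] of labels along
    its maximal right paths, and can be regrown from them. The diagonal carries
    exactly the labels [i] that occur in [B_i], in decreasing order from the
    root; the node labeled [i] there starts the right path [B_i]. Off the
    diagonal, the condition nub = asctops says that, in in-order, a node has a
    left child if and only if its label [i] is met for the first time, and then
    [B_i] is the right path starting at that left child. As [B_i] only contains
    labels at most [i], this process terminates; as every label occurs in some
    block, downward induction on labels shows that every block is used.
    The rows of a Fishburn matrix are the multiplicities of such blocks. *)

Set Implicit Arguments.
Unset Strict Implicit.
Unset Printing Implicit Defensive.

(** * Recursive descriptions of labels, right paths and the condition nub = asctops *)

Fixpoint subtree (T : tree) (v : node) : tree :=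
  match T, v with
  | Defs.Empty, _ => Defs.Empty
  | Branch _ _ _, [::] => T
  | Branch L _ R, b :: v' => subtree (if b then R else L) v'
  end.

Definition labels (T : tree) : seq nat := map (label T) (inorder T).

Fixpoint right_labels (T : tree) : seq nat :=
  if T is Branch _ l R then l :: right_labels R else [::].

Fixpoint left_labels (T : tree) : seq nat :=
  if T is Branch L l _ then l :: left_labels L else [::].

(* One pair per node with a left child: its label, and the labels along the
   maximal right path that starts at that left child. *)
Fixpoint left_rows (T : tree) : seq (nat * seq nat) :=
  if T is Branch L l R then
    left_rows L
      ++ (if L is Branch _ _ _ then [:: (l, right_labels L)] else [::])
      ++ left_rows R
  else [::].

(* The pairs (i, labels of W_i). *)
Fixpoint rows (T : tree) : seq (nat * seq nat) :=
  if T is Branch L l R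
  then (l, right_labels T) :: rows L ++ left_rows R
  else [::].

(* When the labels in [s] have been met before entering [T], the nodes of [T]
   with a left child are exactly those carrying a new label. *)
Fixpoint left_iff_new (s : seq nat) (T : tree) : bool :=
  if T is Branch L l R then
    [&& left_iff_new s L,
        (if L is Branch _ _ _ then true else false) == (l \notin s ++ labels L)
      & left_iff_new (s ++ labels L ++ [:: l]) R]
  else true.

(* [nub = asctops] holds automatically along the diagonal, so only the right
   subtrees hanging off it are constrained. *)
Fixpoint asctops_new (T : tree) : bool :=
  if T is Branch L l R
  then asctops_new L && left_iff_new (labels L ++ [:: l]) R
  else true.

Lemma labels_Branch L l R : labels (Branch L l R) = labels L ++ l :: labels R.
Proof. by rewrite /labels /= map_cat /= -!map_comp. Qed.

Lemma mem_inorder_Branch L l R v :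
  (v \in inorder (Branch L l R)) =
  (if v is b :: v' then v' \in inorder (if b then R else L) else true).
Proof.
rewrite /= mem_cat inE; case: v => [|[] v] /=; first by rewrite orbT.
- rewrite mem_map; last by move=> ? ? [].
  by case: mapP => [[? _ []]|].
- rewrite mem_map; last by move=> ? ? [].
  by rewrite orbC; case: mapP => [[? _ []]|].
Qed.

Lemma mem_inorder T v :
  (v \in inorder T) = (if subtree T v is Branch _ _ _ then true else false).
Proof.
elim: T v => [|L IHL l R IHR] v //; rewrite mem_inorder_Branch.
by case: v => [|[] v] /=; rewrite ?IHL ?IHR.
Qed.

Lemma subtree_cat T u v : subtree T (u ++ v) = subtree (subtree T u) v.
Proof. by elim: T u => [|L IHL l R IHR] [|[] u] //=; case: v. Qed.

Lemma label_cat T u v : label T (u ++ v) = label (subtree T u) v.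
Proof. by elim: T u => [|L IHL l R IHR] [|[] u] //=; case: v. Qed.

(** For an absent node [index] returns the length of the whole list. This accounts for the second
    value in the left case and makes the right case valid without a membership test. *)
Lemma index_inorder_Branch L l R v :
  index v (inorder (Branch L l R)) =
  match v with
  | [::] => size (inorder L)
  | false :: v' => if v' \in inorder L then index v' (inorder L)
                   else (size (inorder L) + (size (inorder R)).+1)
  | true :: v' => (size (inorder L) + (index v' (inorder R)).+1)
  end.
Proof.
rewrite /= index_cat size_map; case: v => [|[] v] /=.
- by case: mapP => [[? _ []]|]; rewrite ?addn0.
- by case: mapP => [[? _ []]|] // _; rewrite index_map // => ? ? [].
- rewrite mem_map ?index_map; try by move=> ? ? [].
  case: ifP => // _; rewrite memNindex ?size_map //.
  by apply/mapP=> -[].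
Qed.

(** Membership in nub, relative to labels [s] met before [T] is entered. The extra parameter lets
    the condition pass to right subtrees; [s = [::]] gives nub itself. *)
Definition new_label (s : seq nat) (T : tree) (v : node) : bool :=
  label T v \notin
    s ++ map (label T) (take (index v (inorder T)) (inorder T)).

Lemma new_label_Branch s L l R v : v \in inorder (Branch L l R) ->
  new_label s (Branch L l R) v =
  match v with
  | [::] => l \notin s ++ labels L
  | false :: v' => new_label s L v'
  | true :: v' => new_label (s ++ labels L ++ [:: l]) R v'
  end.
Proof.
rewrite mem_inorder_Branch /new_label index_inorder_Branch.
case: v => [|[] v] /= vT.
- by rewrite take_size_cat ?size_map // -map_comp.
- rewrite take_cat size_map ltnNge leq_addr /= addKn /= map_cat /= -map_take.
  by rewrite -!map_comp -!catA.
- by rewrite vT take_cat size_map index_mem vT -map_take -map_comp.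
Qed.

Lemma left_iff_newP s T :
  reflect (forall v, v \in inorder T -> new_label s T v = (lchild v \in inorder T))
          (left_iff_new s T).
Proof.
apply: (iffP idP).
- elim: T s => [|L IHL l R IHR] s // /and3P[/IHL gL /eqP gl /IHR gR] v vT.
  rewrite new_label_Branch //; move: vT; rewrite !mem_inorder_Branch.
  case: v => [|[] v] /= vT; [|exact: gR|exact: gL].
  by rewrite -gl mem_inorder; case: (L).
- elim: T s => [|L IHL l R IHR] s //= g; apply/and3P; split.
  + apply: IHL => v vL; have := g (false :: v).
    by rewrite new_label_Branch ?mem_inorder_Branch //=; apply.
  + have := g [::]; rewrite new_label_Branch ?mem_inorder_Branch // => -> //.
    by rewrite /= mem_inorder; case: (L).
  + apply: IHR => v vR; have := g (true :: v).
    by rewrite new_label_Branch ?mem_inorder_Branch //=; apply.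
Qed.

Lemma maxlabel_ge T x : x \in labels T -> x <= maxlabel T.
Proof.
elim: T x => [|L IHL l R IHR] x //; rewrite labels_Branch mem_cat inE /= !leq_max.
by case/or3P => [/IHL->|/eqP->|/IHR->]; rewrite ?leqnn ?orbT.
Qed.

Lemma maxlabel_mem L l R : maxlabel (Branch L l R) \in labels (Branch L l R).
Proof.
have maxn_mem a b (s : seq nat) : a \in s -> b \in s -> maxn a b \in s.
  by rewrite /maxn; case: ifP.
(* The value 0 of an empty subtree need not be a label, so it is adjoined for the induction. If a
   nonempty tree has maximum 0, its root carries it. *)
have mem0 T : maxlabel T \in 0 :: labels T.
  elim: T => [|{}L IHL {}l {}R IHR] //; rewrite labels_Branch /=.
  apply: (maxn_mem); [|apply: (maxn_mem)]; rewrite inE mem_cat inE ?eqxx ?orbT //.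
  - by move: IHL; rewrite inE => /orP[->|->]; rewrite ?orbT.
  - by move: IHR; rewrite inE => /orP[->|->]; rewrite ?orbT.
have := mem0 (Branch L l R); rewrite inE => /orP[/eqP e|//].
have l0 : l = 0 by apply/eqP; rewrite -leqn0 -e leq_maxl.
by rewrite e labels_Branch mem_cat inE l0 eqxx orbT.
Qed.

Lemma strictly_decreasing_notin L l R :
  strictly_decreasing_left (Branch L l R) -> l \notin labels L.
Proof.
by case/and3P=> + _ _; apply: contraTN => /maxlabel_ge; rewrite -leqNgt.
Qed.

(** Strict decrease to the left makes the root label new, and the root is visited first or has a
    left child, so the root is never constrained. Nodes of the right subtree are never visited
    first, which leaves [left_iff_new] there; the left subtree inherits the condition unchanged. *)
Lemma asctops_newP T : strictly_decreasing_left T ->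
  reflect (forall v, v \in inorder T -> new_label [::] T v =
             (index v (inorder T) == 0) || (lchild v \in inorder T))
          (asctops_new T).
Proof.
move=> sT; apply: (iffP idP).
- elim: T sT => [|L IHL l R IHR] //= sT /andP[gL /left_iff_newP gR] v vT.
  rewrite -/(inorder (Branch L l R)) in vT *.
  rewrite new_label_Branch // index_inorder_Branch.
  have /and3P[_ sL _] := sT; move: vT; rewrite !mem_inorder_Branch.
  case: v => [|[] v] /= vT.
  + rewrite (strictly_decreasing_notin sT) mem_inorder.
    by case: (L) => //= *; rewrite orbT.
  + by rewrite addnS /= gR.
  + by rewrite vT IHL.
- elim: T sT => [|L IHL l R IHR] //= sT g; have /and3P[_ sL _] := sT.
  rewrite -/(inorder (Branch L l R)) in g *.
  apply/andP; split.
  + apply: IHL => // v vL; have := g (false :: v).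
    rewrite new_label_Branch !mem_inorder_Branch // index_inorder_Branch vL.
    exact.
  + apply/left_iff_newP => v vR; have := g (true :: v).
    rewrite new_label_Branch !mem_inorder_Branch // index_inorder_Branch addnS.
    exact.
Qed.

Definition fishburn_struct (T : tree) : Prop :=
  [/\ decreasing T, strictly_decreasing_left T, asctops_new T
    & forall x, (x \in labels T) = (0 < x <= maxlabel T)].

Lemma mem_nub T v : (v \in nub T) = (v \in inorder T) && new_label [::] T v.
Proof.
rewrite mem_filter andbC; congr (_ && _); rewrite /new_label /=.
by rewrite -has_pred1 has_map -all_predC.
Qed.

(** The [k] of regularity must be the largest label. Conversely, if all of 1, ..., k occur then the
    tree has at least k nodes, so the bound of labels by the size comes for free. *)
Lemma fishburnP T : fishburn_tree T <-> fishburn_struct T.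
Proof.
split.
- case=> /and3P[dT sT /allP lT] [k kT Tk] nT; split=> //.
    apply/asctops_newP => // v vT; have := nT v.
    by rewrite mem_nub mem_filter vT /= andbT.
  suff -> : maxlabel T = k by move=> x; rewrite Tk mem_iota add1n ltnS.
  case: T Tk kT {dT sT lT nT} => [|L l R] Tk kT.
    by move: kT; rewrite leqn0 => /eqP.
  apply/eqP; rewrite eqn_leq; apply/andP; split.
    have := maxlabel_mem L l R; rewrite Tk mem_iota add1n ltnS.
    by case/andP.
  case: k Tk {kT} => // k Tk; apply: maxlabel_ge.
  by rewrite [_ \in _]Tk mem_iota ltnS leqnn.
- case=> dT sT nT Tk.
  have sizeT : maxlabel T <= tree_size T.
    rewrite -(size_iota 1 (maxlabel T)) /tree_size -(size_map (label T)).
    apply: uniq_leq_size; rewrite ?iota_uniq // => x.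
    by rewrite mem_iota add1n ltnS -Tk.
  split.
  + rewrite /endotree dT sT /=; apply/allP => v vT.
    have : label T v \in labels T by apply: map_f.
    by rewrite Tk => /andP[-> /leq_trans->].
  + by exists (maxlabel T) => // x; rewrite [LHS]Tk mem_iota add1n ltnS.
  + move=> v; rewrite mem_nub mem_filter [RHS]andbC.
    by apply: andb_id2l; apply: (elimT (asctops_newP sT) nT).
Qed.

(** * Rows: one per label, together partitioning the nodes *)

(** Under [left_iff_new], the keys come from first occurrences of labels outside [s], and every such
    label has exactly one first occurrence. *)
Lemma count_left_rows s T x : left_iff_new s T ->
  count_mem x (unzip1 (left_rows T)) = ((x \in labels T) && (x \notin s)).
Proof.
elim: T s => [|L IHL l R IHR] s // /and3P[gL /eqP gl gR].
have -> : left_rows (Branch L l R) =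
    left_rows L ++ (if l \notin s ++ labels L then [:: (l, right_labels L)]
                    else [::]) ++ left_rows R.
  by rewrite -gl /=; case: (L).
rewrite /unzip1 !map_cat !count_cat (IHL _ gL) (IHR _ gR) {gl gR gL IHL IHR}.
rewrite labels_Branch !mem_cat !inE !negb_or.
have -> : count_mem x [seq i.1 | i <-
    if (l \notin s) && (l \notin labels L) then [:: (l, right_labels L)] else [::]]
    = ((x == l) && (x \notin s) && (x \notin labels L)).
  case: (eqVneq x l) => [->|xl]; first by case: ifP => _ //=; rewrite eqxx.
  by case: ifP => //= _; rewrite eq_sym (negbTE xl).
by case: (x \in s); case: (x \in labels L); case: (x == l); case: (x \in labels R).
Qed.

(** This expresses that asctops(T) has exactly one node of each label. *)
Lemma count_rows T x : strictly_decreasing_left T -> asctops_new T ->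
  count_mem x (unzip1 (rows T)) = (x \in labels T).
Proof.
elim: T => [|L IHL l R IHR] //= sT /andP[gL gR].
have /and3P[_ sL _] := sT.
rewrite /unzip1 map_cat count_cat (IHL sL gL) (count_left_rows _ gR).
have := strictly_decreasing_notin sT; rewrite labels_Branch !mem_cat !inE eq_sym.
case: (eqVneq x l) => [->|_] /=; first by move/negbTE->; rewrite andbF.
by move=> _; case: (x \in labels L); case: (x \in labels R).
Qed.

Lemma mem_rows_keys T x : strictly_decreasing_left T -> asctops_new T ->
  (x \in unzip1 (rows T)) = (x \in labels T).
Proof. by move=> sT gT; rewrite -has_pred1 has_count count_rows //; case: (_ \in _). Qed.

Lemma rows_keys_uniq T : strictly_decreasing_left T -> asctops_new T ->
  uniq (unzip1 (rows T)).
Proof.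
by move=> sT gT; apply: count_mem_uniq => x; rewrite mem_rows_keys // count_rows.
Qed.

(** Every node lies on exactly one maximal right path, which starts at the root or at a left
    child. *)
Lemma perm_labels_left_rows T :
  perm_eq (labels T) (right_labels T ++ flatten (unzip2 (left_rows T))).
Proof.
apply/permP => a; elim: T => [|L IHL l R IHR] //; rewrite count_cat.
have -> : count a (flatten (unzip2 (left_rows (Branch L l R)))) =
    count a (flatten (unzip2 (left_rows L))) + count a (right_labels L)
    + count a (flatten (unzip2 (left_rows R))).
  rewrite /= /unzip2 !map_cat !flatten_cat !count_cat addnA; congr (_ + _ + _).
  by case: (L) => [|L' l' R'] //; rewrite /= cats0.
move: IHL IHR; rewrite labels_Branch !count_cat /=; lia.
Qed.

Lemma perm_labels_rows T : perm_eq (labels T) (flatten (unzip2 (rows T))).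
Proof.
apply/permP => a; elim: T => [|L IHL l R IHR] //.
rewrite labels_Branch /= /unzip2 map_cat flatten_cat ?count_cat /= ?count_cat.
rewrite IHL (permP (perm_labels_left_rows R)) count_cat.
by rewrite addnCA [in LHS](addnCA (count _ _)).
Qed.

Lemma right_labels_sub T : {subset right_labels T <= labels T}.
Proof.
by move=> x xT; rewrite (perm_mem (perm_labels_left_rows T)) mem_cat xT.
Qed.

Lemma left_labels_sub T : {subset left_labels T <= labels T}.
Proof.
elim: T => [|L IHL l R _] // x; rewrite labels_Branch mem_cat !inE.
by case/orP => [->|/IHL->]; rewrite ?orbT.
Qed.

Lemma right_labels_sorted T : decreasing T -> sorted geq (right_labels T).
Proof.
elim: T => [|L _ l R IHR] //= /and3P[_ dR]; rewrite geq_max => /andP[_ Rl].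
rewrite path_min_sorted ?IHR //; apply/allP => x /right_labels_sub/maxlabel_ge xR.
exact: leq_trans xR Rl.
Qed.

Lemma left_labels_sorted T :
  strictly_decreasing_left T -> sorted gtn (left_labels T).
Proof.
elim: T => [|L IHL l R _] //= /and3P[Ll sL _].
rewrite path_min_sorted ?IHL //; apply/allP => x /left_labels_sub/maxlabel_ge xL.
exact: leq_ltn_trans xL Ll.
Qed.

Lemma left_rowsP T i q : decreasing T -> strictly_decreasing_left T ->
  (i, q) \in left_rows T ->
  [/\ q != [::], sorted geq q & all (fun x => x < i) q].
Proof.
elim: T => [|L IHL l R IHR] //= /and3P[dL dR _] /and3P[Ll sL sR].
rewrite !mem_cat => /or3P[||]; [exact: IHL| |exact: IHR].
case: L Ll dL {IHL sL} => [|L' l' R'] // Ll dL; rewrite inE => /eqP[-> ->].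
split=> //; first exact: (@right_labels_sorted (Branch L' l' R')).
apply/allP => x; rewrite -[_ :: _]/(right_labels (Branch L' l' R')).
by move=> /right_labels_sub/maxlabel_ge xL; exact: leq_ltn_trans xL Ll.
Qed.

(** Off the diagonal, row i lies in a left subtree below a node labeled i, so its labels are smaller
    than i. Hence i can occur in its own row only on the diagonal; this is how the diagonal is read
    off from the blocks. *)
Lemma rowsP T i q : decreasing T -> strictly_decreasing_left T ->
  (i, q) \in rows T ->
  [/\ q != [::], sorted geq q, all (fun x => x <= i) q
    & i \in q -> i \in left_labels T].
Proof.
elim: T => [|L IHL l R _] //= dT sT.
have /and3P[dL dR] := dT; rewrite geq_max => /andP[_ Rl].
have /and3P[_ sL sR] := sT.
rewrite inE mem_cat => /or3P[/eqP[-> ->]|/(IHL dL sL)[? ? ? iL]|/(left_rowsP dR sR)].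
- rewrite !inE eqxx; split=> //; first exact: (@right_labels_sorted (Branch L l R)).
  rewrite /= leqnn; apply/allP => x /right_labels_sub/maxlabel_ge xR.
  exact: leq_trans xR Rl.
- by split=> // /iL; rewrite inE orbC => ->.
- case=> q0 sq /allP lq; split=> //; first by apply/allP => x /lq /ltnW.
  by move/lq; rewrite ltnn.
Qed.

Lemma left_labels_rows T i : i \in left_labels T ->
  exists2 q, (i, q) \in rows T & i \in q.
Proof.
elim: T => [|L IHL l R _] //=; rewrite inE => /orP[/eqP->|/IHL[q qL iq]].
  by exists (l :: right_labels R); rewrite !inE eqxx.
by exists q => //; rewrite inE mem_cat qL orbT.
Qed.

Lemma maxlabel_right T : decreasing T -> maxlabel T = head 0 (right_labels T).
Proof. by case: T => //= L l R /and3P[_ _ /maxn_idPl]. Qed.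

Lemma maxlabel_left T : decreasing T -> maxlabel T = head 0 (left_labels T).
Proof. by move/maxlabel_right->; case: T. Qed.

(** * Regrowing a tree from its blocks; uniqueness *)

(* [grow n f s p] has the right path [p]; a node of label [l] gets a left
   subtree, with right path [f l], when [l] is met for the first time in
   in-order (the labels in [s] being met already). The fuel [n] bounds the
   labels of [p]. *)
Fixpoint grow (n : nat) (f : nat -> seq nat) (s p : seq nat) : tree :=
  if n is n'.+1 then
    (fix loop (s p : seq nat) : tree :=
       if p is l :: p' then
         let L := if l \in s then Defs.Empty else grow n' f s (f l) in
         Branch L l (loop (s ++ labels L ++ [:: l]) p')
       else Defs.Empty) s p
  else Defs.Empty.

(** Moving along a right path costs no fuel; only entering a left subtree does. *)
Lemma grow_cons n f s l p : grow n.+1 f s (l :: p) =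
  Branch (if l \in s then Defs.Empty else grow n f s (f l)) l
    (grow n.+1 f
       (s ++ labels (if l \in s then Defs.Empty else grow n f s (f l)) ++ [:: l]) p).
Proof. by []. Qed.

(** [ds] lists the diagonal from the root downward. The block of [d] begins with the diagonal node
    itself, so only [behead (f d)] is left for the right subtree. *)
Fixpoint grow_diag (n : nat) (f : nat -> seq nat) (ds : seq nat) : tree :=
  if ds is d :: ds' then
    let L := grow_diag n f ds' in
    Branch L d (grow n f (labels L ++ [:: d]) (behead (f d)))
  else Defs.Empty.

Definition diag_labels (k : nat) (f : nat -> seq nat) : seq nat :=
  rev [seq i <- iota 1 k | i \in f i].

Lemma diag_labels_sorted k f : sorted gtn (diag_labels k f).
Proof.
rewrite rev_sorted; apply: sorted_filter; last exact: iota_ltn_sorted.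
exact: ltn_trans.
Qed.

Lemma mem_diag_labels k f x :
  (x \in diag_labels k f) = (x \in f x) && (0 < x <= k).
Proof. by rewrite mem_rev mem_filter mem_iota add1n ltnS. Qed.

Definition tree_of_blocks (k : nat) (f : nat -> seq nat) : tree :=
  grow_diag k f (diag_labels k f).

(** [left_iff_new] decides whether each left subtree is empty, and otherwise [f] prescribes its
    right path, so nothing is left to choose. Labels drop strictly to the left, so the fuel
    suffices. *)
Lemma grow_right_labels n f s T : left_iff_new s T -> strictly_decreasing_left T ->
  decreasing T -> (forall i q, (i, q) \in left_rows T -> f i = q) -> maxlabel T <= n ->
  T = grow n f s (right_labels T).
Proof.
elim: n s T => [|n IHn] s T gT sT dT fT nT.
  case: T sT nT {gT dT fT} => //= L l R /and3P[Ll _ _]; rewrite leqn0 => /eqP l0.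
  (* Without fuel [T] must be empty, since a root label exceeds the maximum of its left subtree and
     so is positive. *)
  suff : l <= 0 by rewrite leqNgt (leq_ltn_trans _ Ll).
  by rewrite -l0 leq_maxl.
elim: T s gT sT dT fT nT => [|L _ l R IHR] s // /and3P[gL /eqP gl gR].
case/and3P=> Ll sL sR /and3P[dL dR _] fT nT.
rewrite -[right_labels _]/(l :: right_labels R) grow_cons.
suff <- : L = if l \in s then Defs.Empty else grow n f s (f l).
  congr Branch; apply: IHR => //.
    by move=> i q iq; apply: fT; rewrite /= !mem_cat iq !orbT.
  by apply: leq_trans nT; rewrite /= !leq_max leqnn !orbT.
have lL : l \notin labels L.
  by apply/negP => /maxlabel_ge; rewrite leqNgt Ll.
move: gl; rewrite mem_cat (negbTE lL) orbF.
case: (l \in s) => /=; first by case: (L).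
move=> bL; rewrite (fT l (right_labels L)).
- apply: IHn => //; first by move=> i q iq; apply: fT; rewrite /= !mem_cat iq.
  by rewrite -ltnS (leq_trans Ll) // (leq_trans _ nT) // leq_maxl.
- rewrite /= !mem_cat; case: (L) bL => // L' l' R' _.
  by rewrite inE eqxx orbT.
Qed.

Lemma grow_diag_left_labels n f T : asctops_new T -> strictly_decreasing_left T ->
  decreasing T -> (forall i q, (i, q) \in rows T -> f i = q) -> maxlabel T <= n ->
  T = grow_diag n f (left_labels T).
Proof.
elim: T => [|L IHL l R _] //= /andP[gL gR] /and3P[_ sL sR] /and3P[dL dR _] fT.
rewrite !geq_max => /and3P[ln Ln Rn].
rewrite -IHL // => [|i q iq]; last by apply: fT; rewrite inE mem_cat iq orbT.
congr Branch; rewrite (fT l (l :: right_labels R)) ?inE ?eqxx //=.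
apply: grow_right_labels => // i q iq.
by apply: fT; rewrite inE mem_cat iq !orbT.
Qed.

(** Both lists are strictly decreasing, so it is enough to compare elements: i labels a diagonal
    node exactly when it occurs in its own row. *)
Lemma left_labelsE T f : fishburn_struct T ->
  (forall i q, (i, q) \in rows T -> f i = q) ->
  left_labels T = diag_labels (maxlabel T) f.
Proof.
case=> dT sT gT lT fT.
apply: (@irr_sorted_eq _ gtn) => //.
- by move=> x y z xy yz; apply: ltn_trans yz xy.
- by move=> x; rewrite /= ltnn.
- exact: left_labels_sorted.
- exact: diag_labels_sorted.
- move=> x; rewrite mem_diag_labels -lT.
  apply/idP/andP => [xT|[xf]].
    split; last exact: left_labels_sub.
    by have [q /fT->] := left_labels_rows xT.
  rewrite -mem_rows_keys // => /mapP[[i q] iq /= xi]; rewrite xi in xf *.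
  by have [_ _ _] := rowsP dT sT iq; apply; rewrite -(fT _ _ iq).
Qed.

Lemma tree_of_blocks_eq T f : fishburn_struct T ->
  (forall i q, (i, q) \in rows T -> f i = q) ->
  T = tree_of_blocks (maxlabel T) f.
Proof.
move=> T_fb fT; rewrite /tree_of_blocks -left_labelsE //.
by case: T_fb => dT sT gT _; apply: grow_diag_left_labels.
Qed.

(** * Regrowing a tree from its blocks; existence *)

(* A list of [k] nonempty multisets [f 1], ..., [f k] covering [1, k], with
   [f i] contained in [1, i]; each multiset is given as a decreasing list. *)
Definition block_system (k : nat) (f : nat -> seq nat) : Prop :=
  (forall i, 0 < i <= k ->
     [/\ f i != [::], sorted geq (f i) & all (fun x => 0 < x <= i) (f i)])
  /\ (forall x, 0 < x <= k -> exists2 i, 0 < i <= k & x \in f i).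

(** Blocks are only consulted for labels outside [s], so [f] is constrained there alone. The strict
    bound [x < l] is available because, in the use below, the labels with [l \in f l] have been met
    on the diagonal already. *)
Lemma grow_spec n m f s p : m <= n ->
  (forall l, 0 < l <= m -> l \notin s ->
     [/\ f l != [::], sorted geq (f l) & all (fun x => 0 < x < l) (f l)]) ->
  sorted geq p -> all (fun x => 0 < x <= m) p ->
  let T := grow n f s p in
  [/\ [/\ right_labels T = p, decreasing T & strictly_decreasing_left T],
      left_iff_new s T, all (ltn 0) (labels T)
    & forall i q, (i, q) \in left_rows T -> q = f i].
Proof.
elim: n m s p => [|n IHn] m s p mn fP.
  by case: p => // l p _ /andP[] lm; exfalso; lia.
elim: p s fP => [|l p IHp] s fP //= sp /andP[lm pm].
rewrite -!/(grow n.+1 f _ _).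
set L := if l \in s then _ else _.
have [dL sL gL Ll [bL pL rL]] :
  [/\ decreasing L, strictly_decreasing_left L, left_iff_new s L, maxlabel L < l
    & [/\ (if L is Branch _ _ _ then right_labels L == f l else true)
          /\ (if L is Branch _ _ _ then true else false) = (l \notin s),
          all (ltn 0) (labels L)
        & forall i q, (i, q) \in left_rows L -> q = f i]].
  rewrite /L; case ls: (l \in s); first by split=> //; case/andP: lm.
  have [f0 sf lf] := fP l lm (negbT ls).
  (* All labels of [f l] are below [l], so the label bound drops to [l.-1]. *)
  have [| |//||[rL dL sL] gL pL rowL] := IHn l.-1 s (f l).
  - lia.
  - by move=> l' l'l; apply: fP; lia.
  - by apply: sub_all lf => x; lia.
  split=> //; first rewrite maxlabel_right // rL.
    by case: (f l) f0 lf => // x q _ /andP[/andP[]].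
  split=> //; move: rL f0;
  by case: (grow n f s (f l)) => [<-|L1 l1 R1 ->]; rewrite ?eqxx.
have [|||[rR dR sR] gR pR rowR] := IHp (s ++ labels L ++ [:: l]).
- by move=> l' l'm; rewrite mem_cat negb_or => /andP[l's _]; apply: fP.
- exact: path_sorted sp.
- exact: pm.
rewrite labels_Branch all_cat /= pL pR andbT.
have lL : l \notin labels L by apply/negP => /maxlabel_ge; rewrite leqNgt Ll.
split.
- rewrite rR dL dR Ll sL sR geq_max (ltnW Ll) (maxlabel_right dR) rR.
  by split=> //=; move: sp => /=; case: (p) => //= x q /andP[].
- by rewrite gL mem_cat (negbTE lL) orbF bL.2 eqxx gR.
- by case/andP: lm => ->.
- move=> i q; rewrite !mem_cat => /or3P[|| /rowR //]; first exact: rL.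
  by case: (L) bL => // L' l' R' [/eqP fl _]; rewrite inE => /eqP[-> ->].
Qed.

(** The last hypothesis says that [ds] misses no diagonal label up to its head, which provides the
    strict bounds required by [grow_spec]. *)
Lemma grow_diag_spec n f ds :
  (forall i, 0 < i <= n ->
     [/\ f i != [::], sorted geq (f i) & all (fun x => 0 < x <= i) (f i)]) ->
  sorted gtn ds -> all (fun d => (0 < d <= n) && (d \in f d)) ds ->
  (forall l, 0 < l <= head 0 ds -> l \in f l -> l \in ds) ->
  let T := grow_diag n f ds in
  [/\ [/\ left_labels T = ds, decreasing T & strictly_decreasing_left T],
      asctops_new T, all (ltn 0) (labels T)
    & forall i q, (i, q) \in rows T -> q = f i].
Proof.
move=> fP; elim: ds => [|d ds IH] //= sd /andP[/andP[dn df] dsn] dsP.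
have dds : head 0 ds < d.
  by case: (ds) sd => [|x q] /=; [case/andP: dn|case/andP].
have [|//||] := IH; first exact: path_sorted sd.
  move=> l /andP[l0 lds] lf; have : l \in d :: ds.
    by apply: dsP => //; rewrite l0; lia.
  by rewrite inE => /predU1P[ld|//]; lia.
set L := grow_diag n f ds => -[lL dL sL] gL pL rL.
have Ld : maxlabel L < d by rewrite maxlabel_left // lL.
have [f0 sf lf] := fP d dn.
(* [f d] is decreasing, bounded by [d] and contains [d], so it starts with [d]. *)
have fd : f d = d :: behead (f d).
  case: (f d) f0 sf lf df => // x q _ /= xq /andP[/andP[_ xd] _].
  rewrite inE => /predU1P[<-//|dq]; congr (_ :: _); apply/eqP.
  rewrite eqn_leq xd /=; apply: (allP (order_path_min _ xq)) => //.
  by move=> a b c /= ab bc; apply: leq_trans bc ab.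
have /andP[d0 dn'] := dn.
have [|||] := @grow_spec n d f (labels L ++ [:: d]) (behead (f d)) dn'.
(* A label up to [d] outside [labels L ++ [:: d]] is not diagonal, hence not in its own block. *)
- move=> l /andP[l0 ld]; rewrite mem_cat inE negb_or => /andP[lL' lnd].
  have [|? ? /allP lfl] := fP l; first by rewrite l0 (leq_trans ld).
  split=> //; apply/allP => x xl.
  have /andP[-> xl'] := lfl x xl; rewrite ltn_neqAle xl' andbT /=.
  apply: contraNneq lL' => xE; apply: left_labels_sub; rewrite lL.
  have : l \in d :: ds by apply: dsP; rewrite ?l0 // -{1}xE.
  by rewrite inE (negbTE lnd).
- by rewrite fd in sf; apply: path_sorted sf.
- by rewrite fd in lf; case/andP: lf.
set R := grow n f _ _ => -[rR dR sR] gR pR rowR.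
rewrite labels_Branch all_cat /= pL pR d0 lL dL dR Ld sL sR gL gR.
split=> //.
- split=> //=; rewrite geq_max (ltnW Ld) maxlabel_right // rR /=.
  rewrite fd in sf; move: sf; rewrite /=; case: (behead (f d)) => //= x q.
  by case/andP.
- move=> i q; rewrite inE mem_cat => /or3P[/eqP[-> ->]||]; last exact: rowR.
  + by rewrite rR -fd.
  + exact: rL.
Qed.

Lemma tree_of_blocksP k f : block_system k f ->
  let T := tree_of_blocks k f in
  [/\ fishburn_struct T, maxlabel T = k
    & forall i q, (i, q) \in rows T -> q = f i].
Proof.
case=> fP fcov T.
(* The label k lies in some block i with k <= i <= k, so it is diagonal and heads the list. *)
have hd : head 0 (diag_labels k f) = k.
  have [k0|k0] := posnP k; first by rewrite k0.
  have [|i /andP[i0 ik] ki] := fcov k; first by rewrite k0 leqnn.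
  have ik' : i = k.
    have [|_ _ /allP/(_ _ ki)] := fP i; first by rewrite i0.
    by case/andP=> _ ki'; apply/eqP; rewrite eqn_leq ik.
  have kD : k \in diag_labels k f by rewrite mem_diag_labels k0 leqnn -{2}ik' ki.
  have leD x : x \in diag_labels k f -> x <= k.
    by rewrite mem_diag_labels => /and3P[].
  have := diag_labels_sorted k f.
  case: (diag_labels k f) kD leD => //= x q kq leq_k xq; apply/eqP.
  rewrite eqn_leq leq_k ?inE ?eqxx //=; move: kq; rewrite inE.
  case/predU1P => [->//|kq]; apply: ltnW.
  apply: (allP (order_path_min _ xq)) => //.
  by move=> a b c /= ab bc; apply: ltn_trans bc ab.
have [||||[lT dT sT] gT /allP pT rT] := @grow_diag_spec k f (diag_labels k f).
- exact: fP.
- exact: diag_labels_sorted.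
- by apply/allP => x; rewrite mem_diag_labels andbC.
- by move=> l; rewrite hd mem_diag_labels => -> ->.
rewrite -/(tree_of_blocks k f) -/T in lT dT sT gT pT rT.
have mT : maxlabel T = k by rewrite maxlabel_left // lT.
split=> //; split=> // x; rewrite mT.
apply/idP/idP => [xT|]; first by rewrite [0 < x]pT //= -mT maxlabel_ge.
(* Downward induction on x: a block i containing x has i = x, and x is diagonal, or i > x, and then
   i is a label, so its block is a right path of [T]. *)
have [m] := ubnP (k - x); elim: m x => // m IHm x kx xk.
have [i ik xi] := fcov x xk.
have [_ _ /allP/(_ _ xi)/andP[_]] := fP i ik.
rewrite leq_eqVlt => /predU1P[xE|xlt].
  apply: left_labels_sub; rewrite lT mem_diag_labels xk andbT {2}xE //.
have : i \in labels T by apply: IHm => //; lia.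
rewrite -(mem_rows_keys i sT gT) => /mapP[[i' q] iq /= iE]; rewrite -iE in iq.
rewrite (perm_mem (perm_labels_rows T)); apply/flattenP; exists q.
  by apply/mapP; exists (i, q).
by rewrite (rT _ _ iq).
Qed.

(** * Maximal paths as node sequences, and the identification of W_i *)

Fixpoint branch_length (b : bool) (T : tree) : nat :=
  if T is Branch L _ R then (branch_length b (if b then R else L)).+1 else 0.

Lemma mem_nseq_inorder b T j : (nseq j b \in inorder T) = (j < branch_length b T).
Proof.
elim: T j => [|L IHL l R IHR] j //; rewrite mem_inorder_Branch.
by case: j => [|j] //=; case: (b) IHL IHR => IHL IHR; rewrite ?IHL ?IHR.
Qed.

Lemma path_child b h p : path (fun u w => w == child b u) h p ->
  h :: p = [seq h ++ nseq j b | j <- iota 0 (size p).+1].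
Proof.
elim: p h => [|x p IH] h; first by rewrite /= cats0.
rewrite [path _ _ _]/= => /andP[/eqP-> /IH->].
rewrite size_map size_iota.
change (iota 0 (size p).+2) with (0 :: iota (1 + 0) (size p).+1).
rewrite map_cons cats0 iotaDl -map_comp; congr (_ :: _).
by apply: eq_map => j; rewrite /= /child -cats1 -catA.
Qed.

Lemma sorted_succ_iota n m : sorted (fun x y => y == x.+1) (iota n m).
Proof. by case: m => //= m; elim: m n => //= m IH n; rewrite eqxx IH. Qed.

(** The nodes of a path with head h are h followed by repeated steps [b]. As [v] is not a [b]-child
    it must be h, and maximality fixes the length. *)
Lemma path_throughE b T v : v \in inorder T -> (forall u, v != child b u) ->
  path_through b T v =
  [seq v ++ nseq j b | j <- iota 0 (branch_length b (subtree T v))].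
Proof.
have vb j : (v ++ nseq j b \in inorder T) = (j < branch_length b (subtree T v)).
  by rewrite -mem_nseq_inorder !mem_inorder subtree_cat.
have childS h j : h ++ nseq j.+1 b = child b (h ++ nseq j b).
  by rewrite /child -cats1 -catA -[_.+1]addn1 nseqD.
have lastE h n :
    last root_node [seq h ++ nseq j b | j <- iota 0 n.+1] = h ++ nseq n b.
  by rewrite -addn1 iotaD map_cat last_cat.
move=> vT vroot; apply: xget_unique.
- have := vb 0; rewrite cats0 vT; case m_eq: branch_length => [|m] // _.
  split; last by rewrite /= cats0 inE eqxx.
  apply/and5P; split=> //.
  + apply/allP => u /mapP[j jm ->]; rewrite mem_iota in jm.
    by rewrite vb m_eq; lia.
  + rewrite sorted_map; apply: sub_sorted (sorted_succ_iota _ _) => x y /eqP->.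
    by rewrite /= childS.
  + by rewrite /= cats0; apply/allP => u _.
  + by rewrite lastE -childS vb m_eq ltnn.
- case=> [[//]|h p [/and5P[_ pT sp _ lp] vp]].
  have hp := path_child sp; rewrite hp in vp pT lp.
  have vh : v = h.
    case/mapP: vp => -[|j] _ vE; first by rewrite vE cats0.
    by have := vroot (h ++ nseq j b); rewrite vE childS eqxx.
  rewrite hp -vh; congr [seq _ | _ <- iota _ _].
  rewrite -vh lastE -childS vb in lp.
  apply/eqP; rewrite eqn_leq andbC leqNgt lp -vb; apply: (allP pT).
  rewrite vh; apply: (map_f (fun j => h ++ nseq j b)).
  by rewrite mem_iota add0n ltnS leqnn.
Qed.

Lemma labels_true_path T :
  [seq label T (nseq j true) | j <- iota 0 (branch_length true T)]
  = right_labels T.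
Proof.
elim: T => [|L _ l R IHR] //.
change (iota 0 _) with (0 :: iota (1 + 0) (branch_length true R)).
by rewrite map_cons iotaDl -map_comp /= -IHR.
Qed.

Lemma labels_rpath T v : v \in inorder T -> (forall u, v != rchild u) ->
  map (label T) (rpath T v) = right_labels (subtree T v).
Proof.
move=> vT vr; rewrite /rpath path_throughE // -map_comp -labels_true_path.
by apply: eq_map => j /=; rewrite label_cat.
Qed.

Lemma mem_diag T v : T != Defs.Empty ->
  (v \in diag T) = (v \in inorder T) && (v == nseq (size v) false).
Proof.
move=> T0; rewrite /diag /lpath path_throughE; first last.
- by case.
- by case: T T0 => // *; rewrite mem_inorder.
have -> : subtree T root_node = T by case: (T).
apply/mapP/andP => [[j]|[vT /eqP vE]].
  by rewrite mem_iota => jT ->; rewrite size_nseq mem_nseq_inorder.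
by exists (size v) => //; rewrite mem_iota -(mem_nseq_inorder false) -vE.
Qed.

(** Puts the lowest diagonal node, which has no left child, into asctops(T). *)
Lemma leftmost_index T j : nseq j false \in inorder T ->
  lchild (nseq j false) \notin inorder T -> index (nseq j false) (inorder T) = 0.
Proof.
elim: T j => [|L IHL l R _] // j.
rewrite !mem_inorder_Branch index_inorder_Branch.
case: j => [|j] /=; first by rewrite mem_inorder; case: (L).
by move=> jL; rewrite jL; apply: IHL.
Qed.

Lemma left_rows_node T i q : (i, q) \in left_rows T -> exists v,
  [/\ v \in inorder T, lchild v \in inorder T, label T v = i
    & right_labels (subtree T (lchild v)) = q].
Proof.
elim: T => [|L IHL l R IHR] //=; rewrite !mem_cat.
rewrite -/(inorder (Branch L l R)) => /or3P[/IHL| |/IHR].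
- by case=> v [vL vL' <- <-]; exists (false :: v); rewrite !mem_inorder_Branch.
- case: L {IHL} => [|L' l' R'] //; rewrite inE => /eqP[-> ->].
  by exists [::]; split; rewrite ?mem_inorder.
- by case=> v [vR vR' <- <-]; exists (true :: v); rewrite !mem_inorder_Branch.
Qed.

Lemma rows_node T i q : (i, q) \in rows T -> exists2 v,
  [/\ v \in inorder T, v \in asctops T & label T v = i]
  & if v \in diag T then right_labels (subtree T v) = q
    else lchild v \in inorder T /\ right_labels (subtree T (lchild v)) = q.
Proof.
move=> iq; have T0 : T != Defs.Empty by case: (T) iq.
(* Lying on the diagonal is replaced by consisting of left steps only, a condition stable under
   passing to the left subtree. *)
suff [v [vT <- vP]] : exists v, [/\ v \in inorder T, label T v = i
    & if v == nseq (size v) false then right_labels (subtree T v) = q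
      else lchild v \in inorder T /\ right_labels (subtree T (lchild v)) = q].
  exists v; last by rewrite mem_diag // vT.
  split=> //; rewrite mem_filter vT andbT.
  case: ifP vP => [/eqP vE _|_ [-> _]]; last by rewrite orbT.
  rewrite vE orbC; case: (boolP (lchild _ \in _)) => //= vl.
  by rewrite leftmost_index // -vE.
elim: T iq {T0} => [|L IHL l R _] //=; rewrite inE mem_cat.
rewrite -/(inorder (Branch L l R)) => /or3P[/eqP[-> ->]|/IHL|/left_rows_node].
- by exists [::]; rewrite mem_inorder_Branch.
- case=> v [vL <- vP]; exists (false :: v); rewrite !mem_inorder_Branch.
  by split=> //; rewrite /= eqseq_cons eqxx.
- case=> v [vR vR' <- <-]; exists (true :: v); rewrite !mem_inorder_Branch.
  by split.
Qed.

Lemma nub_inj T u v : u \in nub T -> v \in nub T -> label T u = label T v -> u = v.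
Proof.
wlog le_uv : u v / index u (inorder T) <= index v (inorder T).
  move=> IH un vn uv; case: (leqP (index u (inorder T)) (index v (inorder T))).
    by move/IH; apply.
  by move/ltnW/IH => ->.
rewrite !mem_filter => /andP[_ uT] /andP[/allP vu vT] uv.
move: le_uv; rewrite leq_eqVlt => /orP[/eqP/index_inj->//|lt_uv].
have := vu u; rewrite uv eqxx => /(_ _)/wrap[] //.
rewrite -(nth_index root_node uT) -(nth_take _ lt_uv).
by rewrite mem_nth // size_take index_mem vT.
Qed.

Definition block_labels (T : tree) (i : nat) : seq nat := map (label T) (W T i).

(** As nub = asctops, labels are injective on asctops(T), so [asctop] selects the node behind the
    row. Neither a diagonal node nor a left child is a right child, so the right path starts
    there. *)
Lemma rows_block_labels T i q : fishburn_tree T -> (i, q) \in rows T ->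
  block_labels T i = q.
Proof.
case=> _ _ nT /rows_node[v [vT va vi] vq].
have top : asctop T i = v.
  apply: xget_unique => // u [ua ui].
  by apply: (@nub_inj T); rewrite ?nT // ui.
have T0 : T != Defs.Empty by case: (T) vT.
rewrite /block_labels /W top; case: ifP vq => [vd <-|_ [vl <-]].
  rewrite labels_rpath // => u; apply/eqP => vE.
  move: vd; rewrite mem_diag // vE size_rcons => /andP[_ /eqP].
  by move=> /(congr1 (fun s : node => true \in s)); rewrite mem_rcons mem_nseq andbF.
by rewrite labels_rpath // => u; rewrite /child eqseq_rcons andbF.
Qed.

Lemma fishburn_block_system T : fishburn_tree T ->
  block_system (maxlabel T) (block_labels T).
Proof.
move=> Tf; have [dT sT gT lT] := iffLR (fishburnP T) Tf.
have mem_lab i q x : (i, q) \in rows T -> x \in q -> x \in labels T.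
  move=> iq xq; rewrite (perm_mem (perm_labels_rows T)); apply/flattenP.
  by exists q => //; apply/mapP; exists (i, q).
split=> [i|x]; rewrite -lT.
- rewrite -mem_rows_keys // => /mapP[[i' q] iq /= ->].
  rewrite (rows_block_labels Tf iq).
  have [q0 sq /allP lq _] := rowsP dT sT iq; split=> //.
  apply/allP => x xq; rewrite lq // andbT.
  by have := mem_lab _ _ _ iq xq; rewrite lT => /andP[].
- rewrite (perm_mem (perm_labels_rows T)) => /flattenP[_ /mapP[[i q] iq ->] /= xq].
  exists i; last by rewrite (rows_block_labels Tf iq).
  by rewrite -lT -mem_rows_keys //; apply/mapP; exists (i, q).
Qed.

(** * The matrix of a Fishburn tree and its size *)

Lemma sum_count_mem k q : all (fun x => 0 < x <= k) q ->
  \sum_(j < k) count_mem j.+1 q = size q.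
Proof.
elim: q => [|x q IH] /=; first by rewrite big1.
case/andP => /andP[x0 xk] /IH <-; rewrite big_split /= -add1n; congr (_ + _).
have xk' : x.-1 < k by rewrite prednK.
rewrite (bigD1 (Ordinal xk')) //= prednK // eqxx big1 // => j jx.
by apply/eqP; rewrite eqb0; apply: contraNneq jx => xj; rewrite -val_eqE /= xj.
Qed.

(** Row i sums to the length of W_i, and the paths W_i partition the nodes. *)
Lemma mxsize_beta T : fishburn_tree T -> mxsize (beta T) = tree_size T.
Proof.
move=> Tf; have [dT sT gT lT] := iffLR (fishburnP T) Tf.
have [bP _] := fishburn_block_system Tf.
transitivity (\sum_(i < maxlabel T) size (block_labels T i.+1)).
  apply: eq_bigr => i _; have [|_ _ bi] := bP i.+1; first exact: ltn_ord.
  rewrite -(@sum_count_mem (maxlabel T)); last first.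
    by apply: sub_all bi => x /andP[-> /leq_trans->].
  by apply: eq_bigr => j _; rewrite mxE count_map.
have -> : tree_size T = size (flatten (unzip2 (rows T))).
  by rewrite -(perm_size (perm_labels_rows T)) size_map.
rewrite size_flatten sumnE !big_map.
transitivity (\sum_(r <- rows T) size (block_labels T r.1)); last first.
  by rewrite !big_seq; apply: eq_bigr => -[i q] /(rows_block_labels Tf) ->.
rewrite -(big_map fst xpredT (fun i => size (block_labels T i))).
rewrite (perm_big (index_iota 1 (maxlabel T).+1)) ?big_add1 ?big_mkord //=.
apply: uniq_perm; rewrite ?rows_keys_uniq ?iota_uniq // => x.
by rewrite mem_rows_keys // lT mem_index_iota ltnS.
Qed.

Lemma fishburn_beta T : fishburn_tree T -> fishburn_matrix (beta T).
Proof.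
move=> /fishburn_block_system[bP bcov].
have entryE (i j : 'I_(maxlabel T)) :
    tagged (beta T) i j = count_mem j.+1 (block_labels T i.+1).
  by rewrite mxE count_map.
have entry_neq0 (i j : 'I_(maxlabel T)) :
    (tagged (beta T) i j != 0) = (j.+1 \in block_labels T i.+1).
  by rewrite entryE -lt0n -has_count has_pred1.
split.
- apply/is_trig_mxP => i j ij; apply/eqP; apply/negPn; rewrite entry_neq0.
  apply/negP => ji; have [|_ _ /allP/(_ _ ji)] := bP i.+1; first exact: ltn_ord.
  by rewrite /= ltnS leqNgt ij.
- move=> i; have [|b0 _ bi] := bP i.+1; first exact: ltn_ord.
  case bE: (block_labels T i.+1) b0 bi => [|x q] // _ /andP[/andP[x0 xi] _].
  have xk : x.-1 < maxlabel T by rewrite prednK // (leq_trans xi).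
  by exists (Ordinal xk); rewrite entry_neq0 /= prednK // bE inE eqxx.
- move=> j; have [|i /andP[i0 ik] ji] := bcov j.+1; first exact: ltn_ord.
  have ik' : i.-1 < maxlabel T by rewrite prednK.
  by exists (Ordinal ik'); rewrite entry_neq0 /= prednK.
Qed.

(** * From matrices back to trees; the two maps are inverse *)

Lemma mset_of_rowE k (a : 'I_k -> nat) x :
  (\big[msetD/mset0]_(j < k) msetn (a j) j.+1)%mset x =
  \sum_(j < k | x == j.+1) a j.
Proof.
rewrite (big_morph (fun A : {mset nat}%mset => A x) (id1 := 0) (op1 := addn)).
- by rewrite [RHS]big_mkcond; apply: eq_bigr => j _; rewrite msetnE.
- by move=> A B; rewrite msetE2.
- exact: mset0E.
Qed.

(** Labels decrease weakly along right paths, so sorting gives the only order a block can take on a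
    path. The shift [i.-1] is due to blocks being numbered from 1. *)
Definition block_list (Bs : seq {mset nat}%mset) (i : nat) : seq nat :=
  sort geq (nth mset0 Bs i.-1)%mset.

Definition tree_of_msets (Bs : seq {mset nat}%mset) : tree :=
  tree_of_blocks (size Bs) (block_list Bs).

Lemma count_block_list A (i : 'I_(tag A)) x :
  count_mem x (block_list (blocks_of_matrix A) i.+1) =
  \sum_(j < tag A | x == j.+1) tagged A i j.
Proof.
rewrite /block_list (permP (permEl (perm_sort _ _))) count_mem_mset /=.
by rewrite (nth_map i) ?size_enum_ord // nth_ord_enum mset_of_rowE.
Qed.

Lemma count_block_list_ord A (i j : 'I_(tag A)) :
  count_mem j.+1 (block_list (blocks_of_matrix A) i.+1) = tagged A i j.
Proof. by rewrite count_block_list (big_pred1 j) // => j'; rewrite /= eqSS eq_sym. Qed.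

Lemma geq_total : total geq. Proof. by move=> x y; apply: leq_total. Qed.

Lemma fishburn_matrix_block_system A : fishburn_matrix A ->
  block_system (tag A) (block_list (blocks_of_matrix A)).
Proof.
case=> /is_trig_mxP trA rowA colA.
have mem_b (i j : 'I_(tag A)) :
    (j.+1 \in block_list (blocks_of_matrix A) i.+1) = (tagged A i j != 0).
  by rewrite -count_block_list_ord -lt0n -has_count has_pred1.
split=> [[|i] // iA|[|x] // xA].
- have [j Aij] := rowA (Ordinal iA); split.
  + by move: Aij; rewrite -mem_b; case: block_list.
  + exact: sort_sorted geq_total _.
  + apply/allP => x; rewrite -has_pred1 has_count.
    rewrite (count_block_list (Ordinal iA)) lt0n sum_nat_eq0 negb_forall.
    case/existsP => j'; rewrite negb_imply => /andP[/eqP->].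
    by apply: contraR; rewrite /= ltnS -ltnNge => /(trA (Ordinal iA))/eqP.
- have [i Aix] := colA (Ordinal xA); exists i.+1; first exact: ltn_ord.
  by rewrite -mem_b in Aix.
Qed.

(** The rows of the regrown tree are the sorted blocks of [A], so counting labels in them returns
    the entries. *)
Lemma beta_tree_of_msets A : fishburn_matrix A ->
  fishburn_tree (tree_of_msets (blocks_of_matrix A))
  /\ beta (tree_of_msets (blocks_of_matrix A)) = A.
Proof.
move=> /fishburn_matrix_block_system/tree_of_blocksP.
have -> : tree_of_blocks (tag A) (block_list (blocks_of_matrix A)) =
          tree_of_msets (blocks_of_matrix A).
  by rewrite /tree_of_msets size_map size_enum_ord.
move: (tree_of_msets _) => T [Ts mT rT].
have Tf : fishburn_tree T by apply/fishburnP.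
split=> //; case: Ts => _ sT gT lT.
have bT (i : 'I_(tag A)) : block_labels T i.+1 = block_list (blocks_of_matrix A) i.+1.
  have : i.+1 \in labels T by rewrite lT mT /= ltn_ord.
  rewrite -mem_rows_keys // => /mapP[[i' q] iq /= iE]; rewrite -iE in iq.
  by rewrite (rows_block_labels Tf iq) (rT _ _ iq).
have entryE (i j : 'I_(tag A)) :
    count (fun u => label T u == j.+1) (W T i.+1) = tagged A i j.
  by rewrite -count_block_list_ord -bT count_map.
case: A mT entryE {rT bT} => k M /= mT entryE.
(* The dimensions agree only propositionally, so [M] is transported along [mT]. *)
rewrite /beta; case: k / mT M entryE => M entryE.
by congr Tagged; apply/matrixP => i j; rewrite mxE entryE.
Qed.

Lemma blocks_of_beta T : fishburn_tree T ->
  blocks_of_tree T = blocks_of_matrix (beta T).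
Proof.
move=> /fishburn_block_system[bP _].
rewrite /blocks_of_tree /blocks_of_matrix /=.
rewrite (iotaDl 1 0) -val_enum_ord -!map_comp; apply: eq_map => i /=.
apply/msetP => x; rewrite mset_seqE mset_of_rowE.
have [|_ _ /allP bi] := bP i.+1; first exact: ltn_ord.
case: (boolP (0 < x <= maxlabel T)) => [/andP[x0 xk]|xk].
  have xk' : x.-1 < maxlabel T by rewrite prednK.
  rewrite (big_pred1 (Ordinal xk')); first by rewrite mxE /= prednK // count_map.
  move=> j; apply/eqP/eqP => [xE|->]; last by rewrite /= prednK.
  by apply: val_inj; rewrite /= xE.
rewrite big1 => [|j /eqP xj]; last by case/negP: xk; rewrite xj ltn_ord.
apply/count_memPn; apply: contra xk => /bi /andP[-> xi].
exact: leq_trans xi (ltn_ord i).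
Qed.

Lemma sort_seq_mset q : sorted geq q -> sort geq (seq_mset q) = q.
Proof.
move=> sq; apply: (@sorted_eq _ geq) => //.
- by move=> x y z xy yz; apply: leq_trans yz xy.
- by move=> x y; rewrite andbC => /anti_leq.
- exact: sort_sorted geq_total _.
- by rewrite perm_sort perm_eq_seq_mset.
Qed.

Lemma blocks_of_treeK T : fishburn_tree T -> tree_of_msets (blocks_of_tree T) = T.
Proof.
move=> Tf; have Ts := iffLR (fishburnP T) Tf.
rewrite /tree_of_msets size_map size_iota -tree_of_blocks_eq // => i q iq.
have [dT sT gT lT] := Ts.
have /andP[i0 im] : 0 < i <= maxlabel T.
  by rewrite -lT -mem_rows_keys //; apply/mapP; exists (i, q).
rewrite /block_list (nth_map 0) ?size_iota ?prednK // nth_iota ?prednK //.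
rewrite add1n prednK // -/(block_labels T i) (rows_block_labels Tf iq).
by apply: sort_seq_mset; have [] := rowsP dT sT iq.
Qed.

(** Every Fishburn tree is regrown from its blocks, so the tree chosen by [betabar] is unique. *)
Lemma betabarE A : fishburn_matrix A ->
  betabar A = tree_of_msets (blocks_of_matrix A).
Proof.
move=> Af; have [Tf bT] := beta_tree_of_msets Af.
apply: xget_unique => [|T [T_f <-]]; last by rewrite blocks_of_treeK.
by split=> //; rewrite blocks_of_beta // bT.
Qed.

Lemma betaK T : fishburn_tree T -> betabar (beta T) = T.
Proof.
move=> Tf; rewrite betabarE; last exact: fishburn_beta.
by rewrite -blocks_of_beta // blocks_of_treeK.
Qed.

Lemma betabarP A : fishburn_matrix A ->
  fishburn_tree (betabar A) /\ beta (betabar A) = A.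
Proof. by move=> Af; rewrite betabarE //; apply: beta_tree_of_msets. Qed.

Lemma betabar_inj : set_inj fishburn_matrices betabar.
Proof.
move=> A A'; rewrite !inE => /betabarP[_ bA] /betabarP[_ bA'] e.
by rewrite -bA e bA'.
Qed.

(** * Finiteness and counting *)

Lemma finite_fishburn_matrices n : finite_set (fishburn_matrices_of_size n).
Proof.
pose F (x : {k : 'I_n.+1 & 'M['I_n.+1]_k}) : sqmatrix :=
  Tagged (fun k => 'M[nat]_k) (map_mx (@nat_of_ord n.+1) (tagged x)).
apply: sub_finite_set (finite_image F (@finite_finset _ setT)).
move=> [k M] [[_ rowM _] sM] /=.
(* Each of the k rows contributes at least 1 to the sum n. *)
have kn : k < n.+1.
  rewrite ltnS -sM -[k in k <= _]card_ord -sum1_card; apply: leq_sum => i _.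
  have [j Mij] := rowM i; rewrite (bigD1 j) //=.
  by apply: leq_trans (leq_addr _ _); rewrite lt0n.
have Mn i j : M i j < n.+1.
  by rewrite ltnS -sM /mxsize (bigD1 i) //= (bigD1 j) //= -addnA leq_addr.
exists (Tagged (fun k : 'I_n.+1 => 'M['I_n.+1]_k)
         (\matrix_(i < Ordinal kn, j < Ordinal kn) Ordinal (Mn i j))%R) => //.
rewrite /F /=; congr Tagged; apply/matrixP => i j.
by rewrite !mxE.
Qed.

Theorem corollary5p2 :
  [/\ set_bij fishburn_trees fishburn_matrices beta,
      set_bij fishburn_matrices fishburn_trees betabar,
      (forall T, fishburn_tree T -> betabar (beta T) = T)
        /\ (forall A, fishburn_matrix A -> beta (betabar A) = A),
      (forall T, fishburn_tree T -> mxsize (beta T) = tree_size T)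
        /\ (forall A, fishburn_matrix A -> tree_size (betabar A) = mxsize A)
    & forall n : nat, 1 <= n ->
        [/\ finite_set (fishburn_trees_of_size n),
            finite_set (fishburn_matrices_of_size n)
          & #|` fset_set (fishburn_trees_of_size n)|%fset
            = #|` fset_set (fishburn_matrices_of_size n)|%fset]].
Proof.
have size_betabar A : fishburn_matrix A -> tree_size (betabar A) = mxsize A.
  by case/betabarP => Tf bT; rewrite -mxsize_beta // bT.
split.
- split; first exact: fishburn_beta.
  + move=> T T'; rewrite !inE => Tf T'f e.
    by rewrite -(betaK Tf) -(betaK T'f) e.
  + by move=> A /betabarP[Tf bT]; exists (betabar A).
- split; first by move=> A /betabarP[].
  + exact: betabar_inj.
  + by move=> T Tf; exists (beta T); [exact: fishburn_beta|exact: betaK].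
- by split; [exact: betaK|move=> A /betabarP[]].
- by split; [exact: mxsize_beta|exact: size_betabar].
move=> n _.
(* Trees of size n form the injective image of a finite set of matrices, which gives finiteness and
   equality of cardinals together. *)
have img : fishburn_trees_of_size n = (betabar @` fishburn_matrices_of_size n)%classic.
  apply/seteqP; split=> [T [Tf Tn]|_ [A [Af An] <-]].
    exists (beta T); last exact: betaK.
    by split; [exact: fishburn_beta|rewrite mxsize_beta].
  by split; [have [] := betabarP Af|rewrite size_betabar].
have finM := finite_fishburn_matrices n.
split=> //; rewrite img; first exact: finite_image.
apply/fcard_eq => //; first exact: finite_image.
apply: inj_card_eq; apply: sub_in2 betabar_inj => A.
by rewrite !inE => -[].
Qed.
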